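(* Let $n\ge 1$. The map $A=(a_1,\ldots,a_n)\mapsto \mathbf{in}(A)=(\mathbf{in}(a_1),\ldots,\mathbf{in}(a_n))$, where an integer sequence $(f_1,\ldots,f_n)$ is regarded as the function $k\mapsto f_k$, is a bijection between the set of distinguished bases of the $A_n$ root system consisting of positive roots and the set $\mathrm{PF}_n$ of parking functions on $n$ elements.
   Context: Let $e_1,\ldots,e_n$ be the positive simple roots of the $A_n$ root system; the positive roots are $e_{ij}=e_i+e_{i+1}+\cdots+e_j$, $1\le i\le j\le n$, and the roots are $\pm e_{ij}$. The Seifert form is the (non-symmetric) bilinear form on the root lattice with $\langle e_i,e_i\rangle=1$, $\langle e_i,e_{i+1}\rangle=-1$, and $\langle e_i,e_j\rangle=0$ for $j\ne i,i+1$. A distinguished basis is an ordered basis $(a_1,\ldots,a_n)$ of the root lattice consisting of roots such that $\langle a_j,a_i\rangle=0$ for all $j>i$; only those made of positive roots are considered. For a positive root $e_{ij}$ put $\mathbf{in}(e_{ij})=i$. A parking function on $n$ elements is a function $f:\{1,\ldots,n\}\to\{1,\ldots,n\}$ with $|f^{-1}(\{1,\ldots,k\})|\ge k$ for all $k\in\{1,\ldots,n\}$; $\mathrm{PF}_n$ is the set of these. *)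

(* Defs.v *)
From mathcomp Require Import all_boot all_order all_algebra.
From mathcomp Require Import boolp classical_sets functions.

Set Implicit Arguments.
Unset Strict Implicit.
Unset Printing Implicit Defensive.

Import GRing.Theory.
Local Open Scope ring_scope.

(* Indices are elements of 'I_n = {0, ..., n-1}: the integer k of {1, ..., n}
   is represented by the ordinal of value k - 1.
   The root lattice is the free Z-module 'rV[int]_n of coordinates with respect
   to the simple roots. *)

Definition simple_root n (i : 'I_n) : 'rV[int]_n := delta_mx 0 i.

Definition eroot n (i j : 'I_n) : 'rV[int]_n :=
  \sum_(k < n | (i <= k <= j)%N) simple_root k.

Definition is_pos_root n (v : 'rV[int]_n) : bool :=
  [exists ij : 'I_n * 'I_n, (ij.1 <= ij.2)%N && (v == eroot ij.1 ij.2)].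

Definition is_root n (v : 'rV[int]_n) : bool :=
  is_pos_root v || is_pos_root (- v).

Definition pos_root n := {v : 'rV[int]_n | is_pos_root v}.

(* The pair (i, j) chosen here is unique, see in_rootE below. *)
Definition in_root n (r : pos_root n) : 'I_n := (xchoose (existsP (valP r))).1.

Definition seifert_gram n : 'M[int]_n :=
  \matrix_(i, j) (if j == i then 1 else if j == i.+1 :> nat then -1 else 0).

Definition seifert n (u v : 'rV[int]_n) : int :=
  (u *m seifert_gram n *m v^T) 0 0.

Definition lattice_basis n (a : 'I_n -> 'rV[int]_n) : Prop :=
  forall v : 'rV[int]_n, exists! c : 'rV[int]_n, v = \sum_(i < n) c 0 i *: a i.

Definition distinguished_basis n (a : 'I_n -> 'rV[int]_n) : Prop :=
  [/\ lattice_basis a,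
      forall i, is_root (a i)
    & forall i j : 'I_n, (i < j)%N -> seifert (a j) (a i) = 0].

Definition pos_distinguished_bases n : set {ffun 'I_n -> pos_root n} :=
  [set A | distinguished_basis (fun k => val (A k))]%classic.

Definition in_seq n (A : {ffun 'I_n -> pos_root n}) : {ffun 'I_n -> 'I_n} :=
  [ffun k => in_root (A k)].

(* In the 0-based indexing, f x < k says that the value of f lies among the
   first k indices. *)
Definition parking_function n (f : {ffun 'I_n -> 'I_n}) : Prop :=
  forall k : nat, (1 <= k <= n)%N -> (k <= #|[pred x | (f x < k)%N]|)%N.

Definition PF n : set {ffun 'I_n -> 'I_n} :=
  [set f | parking_function f]%classic.

Lemma seifert_simple n (i j : 'I_n) :
  seifert (simple_root i) (simple_root j) = seifert_gram n i j.
Proof.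
by rewrite /seifert /simple_root -rowE trmx_delta -colE !mxE.
Qed.

Lemma eroot_coord n (i j k : 'I_n) : eroot i j 0 k = (i <= k <= j)%N%:R.
Proof.
rewrite /eroot summxE big_mkcond (bigD1 k) //= big1 ?addr0 => [|l lk].
  by rewrite mxE !eqxx; case: ifP.
by rewrite mxE eqxx eq_sym (negPf lk); case: ifP.
Qed.

Lemma in_rootE n (r : pos_root n) (i j : 'I_n) :
  (i <= j)%N -> val r = eroot i j -> in_root r = i.
Proof.
move=> ij rE; have := xchooseP (existsP (valP r)); rewrite /in_root.
move: (xchoose _) => [i' j'] /= /andP[ij' /eqP]; rewrite rE => eE.
apply/val_inj/eqP.
have coordE (k : 'I_n) : (i <= k <= j)%N = (i' <= k <= j')%N.
  have := congr1 (fun v : 'rV[int]_n => v 0 k) eE.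
  by rewrite !eroot_coord; case: (i <= k <= j)%N; case: (i' <= k <= j')%N.
have := coordE i; have := coordE i'; rewrite !leqnn ij ij' /= eqn_leq.
by move=> /andP[-> _] /esym/andP[-> _].
Qed.

(* Main.v *)
Require Import Defs.
From mathcomp Require Import all_boot all_order all_algebra.
From mathcomp Require Import boolp classical_sets functions.
From mathcomp Require Import zify.

Set Implicit Arguments.
Unset Strict Implicit.
Unset Printing Implicit Defensive.

Import GRing.Theory.
Local Open Scope ring_scope.

(** A positive root e_ij is encoded as the half-open interval (x, y] with
    x = i - 1 and y = j, thought of as an edge joining x < y among the vertices
    0, ..., n. Since pairing with e_ij on the right telescopes, two roots with
    intervals e (earlier) and f (later) are orthogonal in the required sense
    exactly when f contains both endpoints of e or neither
    ([seifert_interval_eq0]). The basis condition is then automatic: the Gram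
    matrix of such a sequence is unitriangular, so the coordinate matrix has an
    invertible determinant ([semiorth_unitmx]). What remains is to show that a
    sequence of n intervals with this pairwise condition is determined by its
    left endpoints and that these can be any parking function.

    This goes by induction on n. Let m be the largest left endpoint, and look
    at its last occurrence in the sequence. There the interval must be
    (m, m+1], a simple root ([last_max_simple]): unimodularity forces some
    interval to have m+1 as an endpoint, and orthogonality to the chosen
    interval leaves no other possibility. Orthogonality to (m, m+1] says that
    earlier intervals do not have m+1 as an endpoint, and later ones do not
    have m. Identifying the vertices m and m+1 therefore loses no information:
    it can be undone by skipping m+1 before the removed root and m after it
    ([insert_simple]), and it preserves and reflects pairwise orthogonality
    ([pairwise_insert_simple]). On left endpoints, the operation deletes one
    maximal entry, and deleting or inserting a maximal entry (of value at most
    n) preserves the parking condition ([parking_seq_insert_max]). So existence,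
    uniqueness and the parking property all pass from n to n+1. *)
(** * Orthogonality of positive roots as a condition on intervals *)

Definition covers (f : nat * nat) (t : nat) : bool := (f.1 < t <= f.2)%N.

Definition compat (e f : nat * nat) : bool := covers f e.1 == covers f e.2.

Definition interval_vec n (e : nat * nat) : 'rV[int]_n :=
  \row_(k < n) (covers e k.+1)%:R.

(** The 0-based ordinal i is already the excluded left end of the interval, while
    the included right end is the 1-based index j.+1. *)
Lemma eroot_interval n (i j : 'I_n) : eroot i j = interval_vec n (val i, j.+1).
Proof. by apply/rowP => k; rewrite eroot_coord mxE /covers /= !ltnS. Qed.

(** Each row of the Gram matrix has 1 on the diagonal and -1 just after it, so
    multiplying by it takes successive differences; [covers f 0] is false, which
    makes the formula uniform at b = 0. *)
Lemma mul_interval_gram n (f : nat * nat) (b : 'I_n) :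
  (interval_vec n f *m seifert_gram n) 0 b
    = (covers f b.+1)%:R - (covers f b)%:R.
Proof.
rewrite mxE (eq_bigr (fun a : 'I_n =>
  (covers f b.+1)%:R *+ (a == b) - (covers f b)%:R *+ (b == a.+1 :> nat))); last first.
  move=> a _; rewrite !mxE eq_sym -!val_eqE /=.
  case: eqP => [->|_]; first by rewrite -[_ == _.+1]negbK neq_ltn leqnn /= mulr1 mulr0n subr0.
  by case: eqP => [->|_]; rewrite ?mulr0n ?mulrN1 ?mulr0 !sub0r ?oppr0.
rewrite big_split /= sumrN; congr (_ - _).
  by rewrite (bigD1 b) //= eqxx big1 ?addr0 // => a /negPf ->.
case: b => -[|b] lt_b /=; first by rewrite big1 // => a _; rewrite /covers ltn0 mul0rn.
rewrite (bigD1 (Ordinal (ltnW lt_b))) //= eqxx big1 ?addr0 // => a.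
by rewrite -val_eqE /= eqSS eq_sym => /negPf ->.
Qed.

(** The differences given by [mul_interval_gram] are summed over a contiguous
    range of indices, hence telescope to the two endpoints of e. *)
Lemma seifert_interval n (e f : nat * nat) : (e.1 <= e.2 <= n)%N ->
  seifert (interval_vec n f) (interval_vec n e)
    = (covers f e.2)%:R - (covers f e.1)%:R.
Proof.
move=> /andP[le12 le2n]; rewrite /seifert mxE.
rewrite -(telescope_sumr (fun t => (covers f t)%:R) le12).
rewrite (big_nat_widen _ _ _ _ _ le2n) (big_nat_widenl _ 0) //= big_mkord [RHS]big_mkcond /=.
apply: eq_bigr => b _; rewrite mul_interval_gram mxE mxE {3}/covers ltnS andbC.
by case: ifP => _; rewrite ?mulr1 ?mulr0.
Qed.

Lemma seifert_interval_eq0 n (e f : nat * nat) : (e.1 <= e.2 <= n)%N ->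
  (seifert (interval_vec n f) (interval_vec n e) == 0) = compat e f.
Proof.
move=> le_e; rewrite seifert_interval // /compat.
by case: (covers f e.1); case: (covers f e.2).
Qed.

Lemma seifert_interval_self n (e : nat * nat) : (e.1 < e.2 <= n)%N ->
  seifert (interval_vec n e) (interval_vec n e) = 1.
Proof.
move=> /andP[lt12 le2n].
by rewrite seifert_interval ?(ltnW lt12) // /covers lt12 leqnn ltnn.
Qed.

(** * Unimodularity *)

(** The Gram matrix M G M^T is unitriangular, so its determinant 1 is a multiple
    of the determinant of M. *)
Lemma semiorthogonal_unitmx n (a : 'I_n -> 'rV[int]_n) :
    (forall i, seifert (a i) (a i) = 1) ->
    (forall i j : 'I_n, (i < j)%N -> seifert (a j) (a i) = 0) ->
  \matrix_i a i \in unitmx.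
Proof.
move=> a_diag a_orth; set M := \matrix_i a i.
have gramE i j : (M *m seifert_gram n *m M^T) i j = seifert (a i) (a j).
  rewrite /seifert -(rowK a i) -(rowK a j) -/M.
  by rewrite -row_mul tr_row !mxE; apply: eq_bigr => k _; rewrite !mxE.
have : \det (M *m seifert_gram n *m M^T) = 1.
  rewrite -det_tr det_trig; last first.
    by apply/is_trig_mxP => i j lt_ij; rewrite mxE gramE a_orth.
  by rewrite big1 // => i _; rewrite mxE gramE.
rewrite !det_mulmx -mulrA => det1; rewrite unitmxE.
by apply/unitrPr; eexists; apply: det1.
Qed.

Lemma unitmx_lattice_basis n (a : 'I_n -> 'rV[int]_n) :
  \matrix_i a i \in unitmx -> lattice_basis a.
Proof.
move=> unitM v.
have sumE (c : 'rV_n) : \sum_i c 0 i *: a i = c *m \matrix_i a i.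
  by rewrite mulmx_sum_row; apply: eq_bigr => i _; rewrite rowK.
exists (v *m invmx (\matrix_i a i)); split; first by rewrite sumE mulmxKV.
by move=> c ->; rewrite sumE mulmxK.
Qed.

(** * Semi-orthogonal sequences of intervals *)

Definition semiorth n (s : seq (nat * nat)) : bool :=
  [&& size s == n, all (fun e => e.1 < e.2 <= n)%N s & pairwise compat s].

Lemma semiorth_mem_nth n s (i : 'I_n) : semiorth n s -> nth (0, 0)%N s i \in s.
Proof. by move=> /and3P[/eqP size_s _ _]; rewrite mem_nth ?size_s. Qed.

Lemma semiorth_unitmx n s : semiorth n s ->
  \matrix_(i < n) interval_vec n (nth (0, 0)%N s i) \in unitmx.
Proof.
move=> s_orth; have mem_s i := semiorth_mem_nth i s_orth.
case/and3P: s_orth => /eqP size_s /allP s_bnd /(pairwiseP (0, 0)%N) s_orth.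
have bnd (i : 'I_n) := s_bnd _ (mem_s i).
apply: semiorthogonal_unitmx => [i|i j lt_ij]; first exact: seifert_interval_self.
apply/eqP; rewrite seifert_interval_eq0; last by have /andP[/ltnW-> ->] := bnd i.
by apply: s_orth; rewrite ?inE ?size_s.
Qed.

(** If no interval had v as an endpoint, then coordinates v and v + 1 would agree
    on all roots of the sequence, and these could not form a basis. *)
Lemma semiorth_endpoint n s v : semiorth n s -> (0 < v < n)%N ->
  exists2 e, e \in s & e.1 = v \/ e.2 = v.
Proof.
move=> s_orth /andP[v_gt0 lt_vn].
suff /hasP[e se /orP[]/eqP ev] : has (fun e => (e.1 == v) || (e.2 == v)) s.
- by exists e => //; left.
- by exists e => //; right.
apply/contraT => /hasPn no_end.
have := semiorth_unitmx s_orth.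
rewrite unitmxE -det_tr (@determinant_alternate _ _ _
  (Ordinal (leq_ltn_trans (leq_pred v) lt_vn)) (Ordinal lt_vn)) ?unitr0 //.
  by rewrite -val_eqE /=; lia.
move=> i; rewrite !mxE /= /covers prednK //.
have := no_end _ (semiorth_mem_nth i s_orth).
by case: (nth _ s i) => x y /= no_xy; congr (nat_of_bool _)%:R; lia.
Qed.

(** * Inserting a simple root *)

Definition bump2 h (e : nat * nat) : nat * nat := (bump h e.1, bump h e.2).

(** The vertex m of the smaller problem is split into m and m+1, with the new edge
    between them. [bump h] is the increasing enumeration of the integers other
    than h, so earlier edges attached to m stay at m while later ones move to
    m+1, as orthogonality to the new edge requires. *)
Definition insert_simple m (s1 s2 : seq (nat * nat)) : seq (nat * nat) :=
  map (bump2 m.+1) s1 ++ (m, m.+1) :: map (bump2 m) s2.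

(** The pairwise condition only involves comparisons u < v between an endpoint u
    of the later edge and an endpoint v of the earlier one. These are unchanged by
    a common increasing map, and also by moving u by [bump m] and v by
    [bump m.+1]: the two maps differ only at m, sending u = m to m+1 and v = m to
    m, and for u = v = m the comparison is false before and after. *)
Lemma pairwise_insert_simple m s1 s2 :
  pairwise compat (insert_simple m s1 s2) = pairwise compat (s1 ++ s2).
Proof.
have bumpE h e f : compat (bump2 h e) (bump2 h f) = compat e f.
  by rewrite /compat /covers /bump2 /bump /=; lia.
have crossE e f : compat (bump2 m.+1 e) (bump2 m f) = compat e f.
  by rewrite /compat /covers /bump2 /bump /=; lia.
have before e : compat (bump2 m.+1 e) (m, m.+1).
  by rewrite /compat /covers /bump2 /bump /=; lia.
have after f : compat (m, m.+1) (bump2 m f).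
  by rewrite /compat /covers /bump2 /bump /=; lia.
have pairwiseE h s : pairwise compat (map (bump2 h) s) = pairwise compat s.
  by rewrite pairwise_map; apply: eq_pairwise => e f; apply: bumpE.
rewrite /insert_simple !pairwise_cat /= !pairwiseE allrel_consr.
rewrite allrel_mapl allrel_mapr !all_map.
rewrite (eq_allrel crossE) (eq_all before) (eq_all after) !all_predT /=.
by [].
Qed.

Lemma map_fst_insert_simple m s1 s2 :
    all (fun e => e.1 <= m)%N s1 -> all (fun e => e.1 < m)%N s2 ->
  map fst (insert_simple m s1 s2) = map fst s1 ++ m :: map fst s2.
Proof.
move=> /allP s1m /allP s2m; rewrite /insert_simple map_cat /= -!map_comp.
congr (_ ++ _ :: _); apply/eq_in_map => e.
  by move/s1m; rewrite /= /bump; lia.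
by move/s2m; rewrite /= /bump; lia.
Qed.

Lemma semiorth_insert_simple n m s1 s2 : (m <= n)%N ->
  semiorth n (s1 ++ s2) -> semiorth n.+1 (insert_simple m s1 s2).
Proof.
move=> le_mn; rewrite /semiorth pairwise_insert_simple => /and3P[/eqP sz bnd ->].
move: sz bnd; rewrite /insert_simple !size_cat /= !size_map addnS => ->.
rewrite eqxx andbT /= !all_cat /= !all_map => /andP[/allP b1 /allP b2].
apply/and3P; split; last (apply/allP => e /b2; rewrite /= /bump; lia).
  by apply/allP => e /b1; rewrite /= /bump; lia.
by lia.
Qed.

Lemma split_map (T U : Type) (f : T -> U) s x1 y x2 :
    map f s = x1 ++ y :: x2 ->
  exists s1 e s2, [/\ s = s1 ++ e :: s2, map f s1 = x1, f e = y & map f s2 = x2].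
Proof.
elim: x1 s => [|x x1 IH] [|e s] //= [fe fs]; first by exists [::], e, s.
have [s1 [e' [s2 [-> <- fe' <-]]]] := IH _ fs.
by exists (e :: s1), e', s2; rewrite /= fe.
Qed.

Lemma bump2K h e : e.1 != h -> e.2 != h -> bump2 h (unbump h e.1, unbump h e.2) = e.
Proof. by case: e => x y /= ? ?; rewrite /bump2 !unbumpK // !inE. Qed.

Lemma bump2_unbump_map h s : all (fun e => (e.1 != h) && (e.2 != h)) s ->
  map (bump2 h) (map (fun e => (unbump h e.1, unbump h e.2)) s) = s.
Proof.
elim: s => //= e s IH /andP[/andP[e1 e2] /IH ->].
by rewrite bump2K.
Qed.

(** Some interval (x, y] has m+1 as an endpoint; as all left endpoints are at most
    m, y = m+1. If w > m+1, an earlier such interval has its right endpoint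
    inside (m, w] but not its left one; a later one has x < m, hence contains m
    but not w. Both contradict orthogonality. *)
Lemma last_max_simple n s1 m w s2 : semiorth n (s1 ++ (m, w) :: s2) ->
    all (fun e => e.1 <= m)%N s1 -> all (fun e => e.1 < m)%N s2 ->
  w = m.+1.
Proof.
move=> s_orth /allP le1 /allP lt2; case: (s_orth) => /and3P[_ s_bnd].
move: s_bnd; rewrite all_cat /= => /and3P[_ /andP[lt_mw le_wn] _].
rewrite pairwise_cat allrel_consr /= => /and4P[/andP[/allP c1 _] _ /allP c2 _].
apply: contrapT => neq_w.
have [|[x y]] := @semiorth_endpoint _ _ m.+1 s_orth; first by lia.
rewrite mem_cat inE => /or3P[e1|/eqP[-> ->]|e2] /=; last 2 first.
- by lia.
- by have := lt2 _ e2; have := c2 _ e2; rewrite /compat /covers /=; lia.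
by have := le1 _ e1; have := c1 _ e1; rewrite /compat /covers /=; lia.
Qed.

(** The splitting is prescribed by the left endpoints alone, so two sequences with
    the same left endpoints contract in the same way; this is what makes the
    induction for uniqueness work. *)
Lemma semiorth_contract n m s x1 x2 : semiorth n.+1 s ->
    map fst s = x1 ++ m :: x2 ->
    all (fun x => x <= m)%N x1 -> all (fun x => x < m)%N x2 ->
  exists s1 s2, [/\ s = insert_simple m s1 s2, semiorth n (s1 ++ s2),
    map fst s1 = x1 & map fst s2 = x2].
Proof.
move=> s_orth xsE; have [t1 [e [t2 [sE <- <- <-]]]] := split_map xsE.
rewrite !all_map {xsE} => le1 lt2.
case: e sE le1 lt2 => [m' w] sE /= le1 lt2; move: s_orth.
rewrite {}sE => s_orth; move: (s_orth); rewrite (last_max_simple s_orth le1 lt2).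
move: m' le1 lt2 {s_orth} => {}m /allP le1 /allP lt2 s_orth.
case/and3P: (s_orth); rewrite all_cat pairwise_cat allrel_consr /=.
move=> /eqP sz /and3P[/allP b1 bm /allP b2] /and4P[/andP[/allP c1 _] _ /allP c2 _].
pose contract h (f : nat * nat) := (unbump h f.1, unbump h f.2).
have t1E : map (bump2 m.+1) (map (contract m.+1) t1) = t1.
  apply/bump2_unbump_map/allP => -[x y] f1; have := le1 _ f1; have := c1 _ f1.
  by have := b1 _ f1; rewrite /compat /covers /=; lia.
have t2E : map (bump2 m) (map (contract m) t2) = t2.
  apply/bump2_unbump_map/allP => -[x y] f2; have := lt2 _ f2; have := c2 _ f2.
  by have := b2 _ f2; rewrite /compat /covers /=; lia.
exists (map (contract m.+1) t1), (map (contract m) t2).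
have insE : t1 ++ (m, m.+1) :: t2
    = insert_simple m (map (contract m.+1) t1) (map (contract m) t2).
  by rewrite /insert_simple t1E t2E.
split=> //; last 2 first.
- by rewrite -map_comp; apply/eq_in_map => -[x y] /le1; rewrite /= /unbump; lia.
- by rewrite -map_comp; apply/eq_in_map => -[x y] /lt2; rewrite /= /unbump; lia.
apply/and3P; split.
- by move: sz; rewrite !size_cat /= !size_map addnS => -[->].
- rewrite all_cat !all_map; apply/andP; split; apply/allP => -[x y] fi.
    have := le1 _ fi; have := c1 _ fi; have := b1 _ fi.
    by rewrite /compat /covers /= /unbump; lia.
  have := lt2 _ fi; have := c2 _ fi; have := b2 _ fi.
  by rewrite /compat /covers /= /unbump; lia.
- by rewrite -(pairwise_insert_simple m) -insE; case/and3P: s_orth.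
Qed.

(** * Left endpoints of semi-orthogonal sequences *)

Definition parking_seq n (xs : seq nat) : Prop :=
  size xs = n /\ forall k, (k <= n)%N -> (k <= count (fun x => x < k)%N xs)%N.

Lemma parking_seq_bound n xs : parking_seq n xs -> all (fun x => x < n)%N xs.
Proof.
move=> [sz /(_ n (leqnn n))]; rewrite -{1}sz => le_sz.
by rewrite all_count eqn_leq count_size.
Qed.

(** Taking the last occurrence of the maximum makes the splitting useful for
    [last_max_simple]: entries after it are strictly smaller. *)
Lemma last_max_split (xs : seq nat) : xs != [::] ->
  exists x1 m x2, [/\ xs = x1 ++ m :: x2,
    all (fun x => x <= m)%N x1 & all (fun x => x < m)%N x2].
Proof.
elim: xs => // x [|y xs] IH _; first by exists [::], x, [::].
have [//|x1 [m [x2 [-> le1 lt2]]]] := IH.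
case: (leqP x m) => [le_xm|lt_mx]; first by exists (x :: x1), m, x2; rewrite /= le_xm.
exists [::], x, (x1 ++ m :: x2); split=> //; rewrite all_cat /= lt_mx /=.
apply/andP; split; first by apply: sub_all le1 => z le_z; apply: leq_ltn_trans lt_mx.
by apply: sub_all lt2 => z lt_z; apply: ltn_trans lt_mx.
Qed.

(** For k at most m the entry m is not counted, and for k larger than m all
    entries of x1 and x2 are counted. *)
Lemma parking_seq_insert_max n m x1 x2 :
    all (fun x => x <= m)%N x1 -> all (fun x => x < m)%N x2 ->
  parking_seq n.+1 (x1 ++ m :: x2) <-> (m <= n)%N /\ parking_seq n (x1 ++ x2).
Proof.
move=> le1 lt2; split=> [pk|[le_mn [sz pk]]].
  split.
    by have := parking_seq_bound pk; rewrite all_cat /= => /and3P[].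
  case: pk => sz pk.
  have {}sz : size (x1 ++ x2) = n by move: sz; rewrite !size_cat /= addnS => -[].
  split=> // k le_kn; case: (leqP k m) => [le_km|lt_mk].
    by have := pk k (leqW le_kn); rewrite !count_cat /= ltnNge le_km.
  suff: all (fun x => x < k)%N (x1 ++ x2) by rewrite all_count sz => /eqP->.
  rewrite all_cat; apply/andP; split.
    by apply: sub_all le1 => z le_z; apply: leq_ltn_trans lt_mk.
  by apply: sub_all lt2 => z lt_z; apply: ltn_trans lt_mk.
split; first by move: sz; rewrite !size_cat /= addnS => ->.
move=> k; rewrite leq_eqVlt ltnS => /orP[/eqP->|/pk]; last first.
  by rewrite !count_cat /=; lia.
have sz' : size (x1 ++ m :: x2) = n.+1 by move: sz; rewrite !size_cat /= addnS => ->.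
suff: all (fun x => x < n.+1)%N (x1 ++ m :: x2) by rewrite all_count sz' => /eqP->.
rewrite all_cat /= ltnS le_mn /=; apply/andP; split.
  by apply: sub_all le1 => z le_z; apply: leq_trans le_mn.
by apply: sub_all lt2 => z lt_z; apply/ltnW/(leq_trans lt_z).
Qed.

Lemma semiorth_parking n s : semiorth n s -> parking_seq n (map fst s).
Proof.
elim: n s => [|n IH] s s_orth.
  by case/and3P: s_orth => /nilP-> _ _; split=> // -[].
have /last_max_split[x1 [m [x2 [xsE le1 lt2]]]] : map fst s != [::].
  by case: s s_orth.
have [s1 [s2 [sE s12_orth s1E s2E]]] := semiorth_contract s_orth xsE le1 lt2.
rewrite xsE; apply/parking_seq_insert_max => //; split.
  have /and3P[_ /allP bnd _] := s_orth.
  have /mapP[e /bnd + mE] : m \in map fst s by rewrite xsE mem_cat mem_head orbT.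
  by rewrite -mE; lia.
by rewrite -s1E -s2E -map_cat; apply: IH.
Qed.

Lemma semiorth_inj n s t :
  semiorth n s -> semiorth n t -> map fst s = map fst t -> s = t.
Proof.
elim: n s t => [|n IH] s t s_orth t_orth.
  by case/and3P: s_orth => /nilP->; case/and3P: t_orth => /nilP->.
have /last_max_split[x1 [m [x2 [xsE le1 lt2]]]] : map fst s != [::].
  by case: s s_orth.
rewrite xsE => /esym xtE.
have [s1 [s2 [-> s12_orth s1E s2E]]] := semiorth_contract s_orth xsE le1 lt2.
have [t1 [t2 [-> t12_orth t1E t2E]]] := semiorth_contract t_orth xtE le1 lt2.
have /(congr1 size) : map fst s1 = map fst t1 by rewrite s1E.
rewrite !size_map => sz1.
have /eqP : s1 ++ s2 = t1 ++ t2.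
  by apply: IH => //; rewrite !map_cat s1E s2E t1E t2E.
by rewrite eqseq_cat // => /andP[/eqP-> /eqP->].
Qed.

Lemma semiorth_surj n xs : parking_seq n xs ->
  exists2 s, semiorth n s & map fst s = xs.
Proof.
elim: n xs => [|n IH] xs pk; first by exists [::]; case: pk => /size0nil->.
have /last_max_split[x1 [m [x2 [xsE le1 lt2]]]] : xs != [::].
  by case: xs pk => // -[].
move: pk; rewrite {}xsE => /parking_seq_insert_max-/(_ le1 lt2)[le_mn /IH[s s_orth sE]].
have s1E : map fst (take (size x1) s) = x1 by rewrite map_take sE take_size_cat.
have s2E : map fst (drop (size x1) s) = x2 by rewrite map_drop sE drop_size_cat.
exists (insert_simple m (take (size x1) s) (drop (size x1) s)).
  by apply: semiorth_insert_simple; rewrite ?cat_take_drop.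
move: le1 lt2; rewrite -{1}s1E -{1}s2E !all_map => le1 lt2.
by rewrite map_fst_insert_simple // s1E s2E.
Qed.

(** * Distinguished bases as semi-orthogonal sequences *)

Definition out_root n (r : pos_root n) : 'I_n := (xchoose (existsP (valP r))).2.

Lemma interval_vec_inj n e f : (e.1 < e.2 <= n)%N -> (f.1 < f.2 <= n)%N ->
  interval_vec n e = interval_vec n f -> e = f.
Proof.
case: e f => [x y] [z w] /= /andP[lt_xy le_yn] /andP[lt_zw le_wn] eq_vec.
have coversE k : (k < n)%N -> covers (x, y) k.+1 = covers (z, w) k.+1.
  move=> lt_kn; have := congr1 (fun v : 'rV[int]_n => v 0 (Ordinal lt_kn)) eq_vec.
  by rewrite !mxE /=; case: (covers (x, y) _); case: (covers (z, w) _).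
have := (coversE x, coversE y.-1, (coversE z, coversE w.-1)).
by rewrite /covers /= => -[[+ +] [+ +]] => *; congr (_, _); lia.
Qed.

Lemma in_out_root n (r : pos_root n) :
  (in_root r <= out_root r)%N /\ val r = eroot (in_root r) (out_root r).
Proof. by have /andP[? /eqP] := xchooseP (existsP (valP r)). Qed.

Definition root_interval n (r : pos_root n) : nat * nat :=
  (val (in_root r), (out_root r).+1).

Lemma root_intervalE n (r : pos_root n) : val r = interval_vec n (root_interval r).
Proof. by rewrite -eroot_interval; case: (in_out_root r). Qed.

Lemma root_interval_bound n (r : pos_root n) :
  ((root_interval r).1 < (root_interval r).2 <= n)%N.
Proof. by rewrite /= ltnS ltn_ord andbT; case: (in_out_root r). Qed.

Lemma root_interval_inj n : injective (@root_interval n).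
Proof. by move=> r r' eq_rr'; apply: val_inj; rewrite !root_intervalE eq_rr'. Qed.

Lemma interval_is_pos_root n e : (e.1 < e.2 <= n)%N -> is_pos_root (interval_vec n e).
Proof.
case: e => x [|y] //= /andP[]; rewrite ltnS => le_xy lt_yn; apply/existsP.
exists (Ordinal (leq_ltn_trans le_xy lt_yn), Ordinal lt_yn) => /=.
by rewrite le_xy eroot_interval /=.
Qed.

Definition root_intervals n (A : {ffun 'I_n -> pos_root n}) : seq (nat * nat) :=
  [seq root_interval (A k) | k <- enum 'I_n].

(** Being roots holds by construction and being a basis follows from
    unimodularity, so only pairwise orthogonality is a condition. *)
Lemma distinguished_semiorth n (A : {ffun 'I_n -> pos_root n}) :
  pos_distinguished_bases A <-> semiorth n (root_intervals A).
Proof.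
have nthE (k : 'I_n) : nth (0, 0)%N (root_intervals A) k = root_interval (A k).
  by rewrite (nth_map k) ?size_enum_ord // nth_ord_enum.
have bnd (k : 'I_n) := root_interval_bound (A k).
have wbnd (k : 'I_n) : ((root_interval (A k)).1 <= (root_interval (A k)).2 <= n)%N.
  by have /andP[/ltnW-> ->] := bnd k.
split=> [[_ _ orth]|A_orth].
  apply/and3P; split; first by rewrite size_map size_enum_ord.
    by rewrite /root_intervals all_map; apply/allP => k _; apply: bnd.
  apply/(pairwiseP (0, 0)%N) => i j; rewrite !inE size_map size_enum_ord => lt_i lt_j lt_ij.
  rewrite (nthE (Ordinal lt_i)) (nthE (Ordinal lt_j)).
  by rewrite -(@seifert_interval_eq0 n) // -!root_intervalE orth.
have valE : (fun k => val (A k)) = fun k => interval_vec n (nth (0, 0)%N (root_intervals A) k).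
  by apply/funext => k; rewrite nthE root_intervalE.
split.
- by rewrite valE; apply/unitmx_lattice_basis/semiorth_unitmx.
- by move=> k; rewrite /is_root (valP (A k)).
- move=> i j lt_ij; apply/eqP; rewrite !root_intervalE seifert_interval_eq0 // -!nthE.
  have /and3P[/eqP sz _ /(pairwiseP (0, 0)%N)] := A_orth.
  by apply=> //; rewrite inE sz.
Qed.

Lemma parking_functionE n (f : {ffun 'I_n -> 'I_n}) :
  PF f <-> parking_seq n [seq val (f k) | k <- enum 'I_n].
Proof.
have countE k : count (fun x => x < k)%N [seq val (f k) | k <- enum 'I_n]
    = #|[pred x | (f x < k)%N]|.
  by rewrite count_map cardE -size_filter; congr size; rewrite enumT.
split=> [pk|[_ pk] k /andP[_ le_kn]]; last by rewrite -countE pk.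
split=> [|[|k] // lt_kn]; first by rewrite size_map size_enum_ord.
by rewrite countE pk.
Qed.

Lemma in_seqE n (A : {ffun 'I_n -> pos_root n}) :
  [seq val (in_seq A k) | k <- enum 'I_n] = map fst (root_intervals A).
Proof. by rewrite /root_intervals -map_comp; apply: eq_map => k; rewrite ffunE. Qed.

Theorem theorem1p5 (n : nat) (hn : (1 <= n)%N) :
  set_bij (@pos_distinguished_bases n) (@PF n) (@in_seq n).
Proof.
split.
- move=> A /distinguished_semiorth A_orth; apply/parking_functionE.
  by rewrite in_seqE; apply: semiorth_parking.
- move=> A B; rewrite !inE => /distinguished_semiorth A_orth /distinguished_semiorth B_orth eqAB.
  have /eq_in_map eqr : root_intervals A = root_intervals B.
    by apply: (semiorth_inj A_orth B_orth); rewrite -!in_seqE eqAB.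
  by apply/ffunP => k; apply/root_interval_inj/eqr; rewrite mem_enum.
- move=> f /parking_functionE/semiorth_surj[s s_orth sE].
  have /and3P[/eqP sz /allP s_bnd _] := s_orth.
  have bnd (k : 'I_n) := s_bnd _ (semiorth_mem_nth k s_orth).
  pose A : {ffun 'I_n -> pos_root n} :=
    [ffun k => exist (@is_pos_root n) _ (interval_is_pos_root (bnd k))].
  have AE : root_intervals A = s.
    apply: (@eq_from_nth _ (0, 0)%N); rewrite size_map size_enum_ord // => k lt_kn.
    rewrite (nth_map (Ordinal lt_kn)) ?size_enum_ord // (nth_ord_enum _ (Ordinal lt_kn)).
    apply: (@interval_vec_inj n); first exact: root_interval_bound.
      exact: (bnd (Ordinal lt_kn)).
    by rewrite -root_intervalE ffunE.
  exists A; first by apply/distinguished_semiorth; rewrite AE.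
  have /eq_in_map eq_in : [seq val (in_seq A k) | k <- enum 'I_n]
      = [seq val (f k) | k <- enum 'I_n] by rewrite in_seqE AE.
  by apply/ffunP => k; apply/val_inj/eq_in; rewrite mem_enum.
Qed.
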